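(* Let $n\ge 1$ and let $A=(a_{ij})_{1\le i,j\le n}$ be the lower triangular matrix such that $(B_0(x),B_1(x),\ldots,B_{n-1}(x))^T=A(1,x,\ldots,x^{n-1})^T$, where $B_0,\dots,B_{n-1}$ are the Bessel polynomials; that is, $$a_{ij}=\begin{cases}\dfrac{(i+j-2)!}{2^{j-1}(i-j)!(j-1)!}, & i\ge j,\\[2mm] 0, & i<j.\end{cases}$$ Then: (i) the pivots of the Neville elimination of $A$ are given by $$p_{ij}=\frac{1}{2^{j-1}}\frac{(i-1)!}{(i-j)!}\prod_{r=1}^{j-1}\frac{2i-r-1}{i-j+r},\qquad 1\le j\le i\le n,$$ and the multipliers by $$m_{ij}=\frac{(2i-2)(2i-3)}{(2i-j-1)(2i-j-2)},\qquad 1\le j<i\le n;$$ (ii) $A$ is a nonsingular totally positive matrix; (iii) the bidiagonal factorization of $A$ is given by $$\mathcal{BD}(A)_{ij}=\begin{cases}\dfrac{(2i-2)(2i-3)}{(2i-j-1)(2i-j-2)}, & i>j,\\ 1, & i=j=1,\\ (2i-3)!!, & i=j>1,\\ 0, & i<j,\end{cases}$$ and it can be computed to high relative accuracy.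
   Context: **Bessel polynomials.** $B_n(x)=\sum_{k=0}^n \frac{(n+k)!}{2^k(n-k)!\,k!}x^k$, $n=0,1,2,\ldots$. **Semifactorial.** For a positive integer $n$, $n!!=\prod_{k=0}^{[n/2]-1}(n-2k)$, where $[\cdot]$ is the integer part; empty products equal $1$. **Totally positive (TP).** A matrix is TP if all its minors are nonnegative. **Neville elimination (NE).** Given a nonsingular $n\times n$ matrix $A$, NE produces a sequence $A=A^{(1)}\to\widetilde A^{(1)}\to A^{(2)}\to\widetilde A^{(2)}\to\cdots\to A^{(n)}=\widetilde A^{(n)}=U$ with $U$ upper triangular. The matrix $\widetilde A^{(t)}$ is obtained from $A^{(t)}$ by moving to the bottom the rows with a zero entry in column $t$ below the main diagonal, if necessary. For $t=1,\dots,n-1$, $A^{(t+1)}$ is obtained from $\widetilde A^{(t)}$ by $$a^{(t+1)}_{ij}=\widetilde a^{(t)}_{ij}-\frac{\widetilde a^{(t)}_{it}}{\widetilde a^{(t)}_{i-1,t}}\,\widetilde a^{(t)}_{i-1,j}\quad\text{if } t\le j\le n,\ t<i\le n,\ \widetilde a^{(t)}_{i-1,t}\ne 0,$$ and $a^{(t+1)}_{ij}=\widetilde a^{(t)}_{ij}$ otherwise. The $(i,j)$ pivot is $p_{ij}=\widetilde a^{(j)}_{ij}$ for $1\le j\le i\le n$. The $(i,j)$ multiplier, for $1\le j<i\le n$, is $m_{ij}=p_{ij}/p_{i-1,j}$ if $\widetilde a^{(j)}_{i-1,j}\ne 0$, and $m_{ij}=0$ if $\widetilde a^{(j)}_{i-1,j}=0$.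 **Bidiagonal factorization.** A nonsingular TP $n\times n$ matrix $A$ has a decomposition $A=F_{n-1}\cdots F_1\,D\,G_1\cdots G_{n-1}$, where $D=\mathrm{diag}(p_{11},\dots,p_{nn})$ contains the diagonal pivots of the NE of $A$. The matrix $F_i$ is lower bidiagonal with unit diagonal, its $(r,r-1)$ entry being $m_{r,r-i}$ for $r=i+1,\dots,n$ and $0$ for $2\le r\le i$. The matrix $G_i^T$ is of the same form with $\widetilde m_{r,r-i}$ in place of $m_{r,r-i}$. Here $m_{ij}$ are the multipliers of the NE of $A$ and $\widetilde m_{ij}$ those of the NE of $A^T$. This factorization is encoded by the matrix $\mathcal{BD}(A)$ with $(\mathcal{BD}(A))_{ij}=m_{ij}$ if $i>j$, $\widetilde m_{ji}$ if $i<j$, and $p_{ii}$ if $i=j$. **High relative accuracy (HRA).** An algorithm can be performed with HRA if it only includes products, divisions, sums of numbers of the same sign, and subtractions of initial data. *)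

(* Defs.v *)
(* Mathematical indices run over 1..n, ordinals over 0..n-1:
   an ordinal i stands for the mathematical index i.+1.  Closed formulas
   ([bessel_entry], [bessel_pivot], [bessel_mult], [bessel_bd]) take the
   mathematical (1-based) indices; the truncated subtractions on nat occurring
   in them are exact in the stated ranges of the indices. *)
From mathcomp Require Import all_boot all_order all_algebra.

Set Implicit Arguments.
Unset Strict Implicit.
Unset Printing Implicit Defensive.

Import Order.TTheory GRing.Theory Num.Theory.

Local Open Scope ring_scope.

Definition semifact (n : nat) : nat := (\prod_(0 <= k < n./2) (n - 2 * k))%N.

Section Bessel.
Variable R : realFieldType.

Definition bessel_poly (n : nat) : {poly R} :=
  \poly_(k < n.+1) ((n + k)`!%:R / (2 ^ k * (n - k)`! * k`!)%:R).

Definition bessel_entry (i j : nat) : R :=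
  if (j <= i)%N
  then (i + j - 2)`!%:R / (2 ^ (j - 1) * (i - j)`! * (j - 1)`!)%:R
  else 0.

Definition bessel_mx (n : nat) : 'M[R]_n :=
  \matrix_(i, j) bessel_entry i.+1 j.+1.

(* range: 1 <= j <= i *)
Definition bessel_pivot (i j : nat) : R :=
  1 / (2 ^ (j - 1))%:R * ((i - 1)`!%:R / (i - j)`!%:R) *
  \prod_(1 <= r < j) ((2 * i - r - 1)%:R / (i - j + r)%:R).

(* range: 1 <= j < i *)
Definition bessel_mult (i j : nat) : R :=
  ((2 * i - 2) * (2 * i - 3))%:R / ((2 * i - j - 1) * (2 * i - j - 2))%:R.

Definition bessel_bd (i j : nat) : R :=
  if (j < i)%N then bessel_mult i j
  else if (i < j)%N then 0
  else if i == 1%N then 1 else (semifact (2 * i - 3))%:R.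

Definition bessel_bd_mx (n : nat) : 'M[R]_n :=
  \matrix_(i, j) bessel_bd i.+1 j.+1.

End Bessel.

Definition ord_subn n (i : 'I_n) (k : nat) : 'I_n :=
  Ordinal (leq_ltn_trans (leq_subr k i) (ltn_ord i)).

Definition totally_positive (R : realFieldType) n (A : 'M[R]_n) : Prop :=
  forall (k : nat) (f g : 'I_k -> 'I_n),
    (forall i j : 'I_k, (i < j)%N -> (f i < f j)%N) ->
    (forall i j : 'I_k, (i < j)%N -> (g i < g j)%N) ->
    0 <= \det (mxsub f g A).

Section Neville.
Variables (R : realFieldType) (n : nat).
Implicit Types (A B M : 'M[R]_n) (i j r t : 'I_n) (k : nat).

(* Row order after moving to the bottom, among the rows t, t+1, ..., those with
   a zero entry in column t; relative orders are preserved. *)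
Definition ne_order t M : seq 'I_n :=
  [seq i : 'I_n <- enum 'I_n | (i < t)%N] ++
  [seq i : 'I_n <- enum 'I_n | (t <= i)%N && (M i t != 0)] ++
  [seq i : 'I_n <- enum 'I_n | (t <= i)%N && (M i t == 0)].

Definition ne_move t M : 'M[R]_n :=
  \matrix_(i, j) M (nth i (ne_order t M) i) j.

Definition ne_elim t M : 'M[R]_n :=
  \matrix_(i, j)
    if [&& (t <= j)%N, (t < i)%N & M (ord_subn i 1) t != 0]
    then M i j - M i t / M (ord_subn i 1) t * M (ord_subn i 1) j
    else M i j.

(* [ne_seq A k] is A^(k+1), for k < n *)
Fixpoint ne_seq A k : 'M[R]_n :=
  if k is k'.+1 then
    if insub k' is Some t then ne_elim t (ne_move t (ne_seq A k'))
    else ne_seq A k'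
  else A.

Definition ne_tilde A t : 'M[R]_n := ne_move t (ne_seq A t).

(* meaningful for j <= i *)
Definition ne_pivot A i j : R := ne_tilde A j i j.

(* meaningful for j < i *)
Definition ne_mult A i j : R :=
  if ne_tilde A j (ord_subn i 1) j != 0
  then ne_pivot A i j / ne_pivot A (ord_subn i 1) j
  else 0.

Definition bd_mx A : 'M[R]_n :=
  \matrix_(i, j)
    if (j < i)%N then ne_mult A i j
    else if (i < j)%N then ne_mult A^T j i
    else ne_pivot A i i.

(* The lower bidiagonal factor F_k (1 <= k < n) encoded by the strictly lower
   part of B; G_k is the transpose of the one encoded by B^T. *)
Definition bd_factor B k : 'M[R]_n :=
  \matrix_(r, c)
    if c == r then 1
    else if (c.+1 == r :> nat) && (k <= r)%N then B r (ord_subn r k)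
    else 0.

(* F_(n-1) ... F_1 D G_1 ... G_(n-1) *)
Definition bd_prod B : 'M[R]_n :=
  (\prod_(1 <= k < n) bd_factor B (n - k)) *m
  diag_mx (\row_i B i i) *m
  (\prod_(1 <= k < n) (bd_factor B^T k)^T).

End Neville.

(* Algorithms restricted to the operations admissible for high relative
   accuracy.  The initial data are exactly known integers: constants, the order
   n of the matrix and the indices, i.e. the counters of the bounded loops.
   Control flow depends on these data only; real numbers are stored in
   registers.  Only initial data can be subtracted. *)
Inductive datum : Type :=
  | Const of nat
  | Size
  | Index of nat.

Inductive hra_expr : Type :=
  | Datum of datum
  | SubData of datum & datum
  | Reg of nat
  | Add of hra_expr & hra_expr
  | Mul of hra_expr & hra_expr
  | Div of hra_expr & hra_expr.

Inductive hra_prog : Type :=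
  | Skip
  | Assign of nat & hra_expr
  | Output of datum & datum & hra_expr  (* set entry (i, j) of the result *)
  | Seq of hra_prog & hra_prog
  | IfLt of datum & datum & hra_prog & hra_prog
  | For of nat & datum & datum & hra_prog.  (* inclusive bounds *)

Section HRA.
Variable R : realFieldType.

Record hra_state : Type := HraState {
  regs : nat -> option R;
  result : nat -> nat -> option R
}.

Definition hra_init : hra_state :=
  HraState (fun=> None) (fun _ _ => None).

Definition datum_val (n : nat) (e : nat -> nat) (d : datum) : nat :=
  match d with Const c => c | Size => n | Index x => e x end.

(* [None] when a sum of numbers of opposite signs, a division by zero or an
   unassigned register occurs *)
Fixpoint hra_eval (n : nat) (e : nat -> nat) (s : hra_state) (a : hra_expr) :
    option R :=
  match a with
  | Datum d => Some (datum_val n e d)%:R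
  | SubData d d' => Some ((datum_val n e d)%:R - (datum_val n e d')%:R)
  | Reg r => regs s r
  | Add b c =>
      if (hra_eval n e s b, hra_eval n e s c) is (Some x, Some y)
      then if 0 <= x * y then Some (x + y) else None
      else None
  | Mul b c =>
      if (hra_eval n e s b, hra_eval n e s c) is (Some x, Some y)
      then Some (x * y) else None
  | Div b c =>
      if (hra_eval n e s b, hra_eval n e s c) is (Some x, Some y)
      then if y != 0 then Some (x / y) else None
      else None
  end.

Fixpoint hra_run (n : nat) (e : nat -> nat) (p : hra_prog) (s : hra_state) :
    option hra_state :=
  match p with
  | Skip => Some s
  | Assign r a =>
      if hra_eval n e s a is Some x
      then Some (HraState [eta regs s with r |-> Some x] (result s))
      else None
  | Output d d' a =>
      let i := datum_val n e d in
      let j := datum_val n e d' in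
      if hra_eval n e s a is Some x
      then Some (HraState (regs s)
             (fun k l => if (k == i) && (l == j) then Some x
                         else result s k l))
      else None
  | Seq p1 p2 => obind (hra_run n e p2) (hra_run n e p1 s)
  | IfLt d d' p1 p2 =>
      if (datum_val n e d < datum_val n e d')%N
      then hra_run n e p1 s else hra_run n e p2 s
  | For x d d' q =>
      foldl (fun o k => obind (hra_run n [eta e with x |-> k] q) o) (Some s)
        (index_iota (datum_val n e d) (datum_val n e d').+1)
  end.

(* One program, independent of n, computes all the entries of all B n. *)
Definition hra_computable (B : forall n, 'M[R]_n) : Prop :=
  exists p : hra_prog, forall n : nat, (0 < n)%N ->
    exists2 s : hra_state,
      hra_run n (fun=> 0%N) p hra_init = Some s &
      forall i j : 'I_n, result s i.+1 j.+1 = Some (B n i j).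

End HRA.

(* Main.v *)
Require Import Defs.
From mathcomp Require Import all_boot all_order all_algebra.
From mathcomp Require Import fingroup perm.
From mathcomp Require Import zify ring lra.

(** Everything rests on a closed form for the matrices that Neville elimination
    goes through.  Write indices from 0.  After k steps, row i (with k <= i) of
    the matrix has the entries
      E(k, i, j) = (i+j-k)! (2i)! (i-k)! /
                   (2^j (i-j)! (j-k)! (2i-k)! i!)     for k <= j <= i,
    and 0 elsewhere ([ne_entry]); the rows i < k are those reached at step i,
    hence diagonal.  The case k = 0 is the Bessel matrix, the entries
    E(k, i, k) are the pivots, and the single recurrence [ne_entry_rec],
      E(k, i, j) = E(k+1, i, j) + m(i, k) E(k, i-1, j)    for k < i,
    where m(i, k) is the claimed multiplier, carries the whole theorem.  After
    clearing factorials it is the polynomial identity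
      (i+j-k)(i-k) = (j-k)(2i-k) + (i-j) i.

    - Elimination: all pivots are positive, so no row is ever moved, and the
      recurrence says that a step turns E(k, ., .) into E(k+1, ., .).  The
      transpose is upper triangular, so elimination leaves it alone and its
      multipliers vanish.

    - Factorization: let C_k be the matrix whose row r is row r of stage r - k
      (truncated subtraction), that is C_k(r, c) = E(r - k, r, c)
      ([partial_prod]).  Read at row r and stage r - k, the recurrence is
      C_k = F_k C_(k-1), while C_0 = D and C_(n-1) = A; hence
      A = F_(n-1) ... F_1 D, and the upper factors are identities.

    - Total positivity: D has it, and adding to each row a nonnegative multiple
      of the preceding row preserves it ([bidiag_totally_positive]).  This last
      fact only needs multilinearity of the determinant, not the Cauchy-Binet
      formula.

    - High relative accuracy: 2i - 3, 2i - j - 1 and 2i - j - 2 (indices from 1)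
      are sums of two nonnegative differences of indices and constants, such as
      (i - 1) + (i - 2), and the semifactorials on the diagonal are accumulated
      from one row to the next. *)

Set Implicit Arguments.
Unset Strict Implicit.
Unset Printing Implicit Defensive.

Import Order.TTheory GRing.Theory Num.Theory.

Local Open Scope ring_scope.

(** * The closed form of the elimination stages *)

Section ClosedForm.
Variable R : realFieldType.
Implicit Types i j k : nat.

Definition ne_entry k i j : R :=
  if (k <= j <= i)%N
  then ((i + j - k)`!%:R * (2 * i)`!%:R * (i - k)`!%:R) /
       ((2 ^ j)%:R * (i - j)`!%:R * (j - k)`!%:R * (2 * i - k)`!%:R * i`!%:R)
  else 0.

Lemma ne_entry_gt0 k i j : (k <= j <= i)%N -> 0 < ne_entry k i j.
Proof.
by move=> kji; rewrite /ne_entry kji divr_gt0 ?mulr_gt0 ?ltr0n ?fact_gt0 ?expn_gt0.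
Qed.

Lemma ne_entry_eq0 k i j : ~~ (k <= j <= i)%N -> ne_entry k i j = 0.
Proof. by rewrite /ne_entry => /negbTE ->. Qed.

Lemma fact_natr_neq0 i : i`!%:R != 0 :> R.
Proof. by rewrite pnatr_eq0 -lt0n fact_gt0. Qed.

Lemma exp2_natr_neq0 i : (2 ^ i)%:R != 0 :> R.
Proof. by rewrite pnatr_eq0 -lt0n expn_gt0. Qed.

Lemma natr_fact_prev i j : i = j.+1 -> i`!%:R = i%:R * j`!%:R :> R.
Proof. by move=> ->; rewrite factS natrM. Qed.

(** The elimination step on the closed form.  Outside k <= j < i at most one
    term on each side survives; inside, all three terms are the common factor C
    times simple fractions, and the identity of these is [key]. *)
Lemma ne_entry_rec k i j : (k < i)%N ->
  ne_entry k i j =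
  ne_entry k.+1 i j + bessel_mult R i.+1 k.+1 * ne_entry k i.-1 j.
Proof.
move=> ki.
have [jk|kj] := ltnP j k.
  by rewrite !ne_entry_eq0 ?mulr0 ?addr0 //; lia.
have [ij|ji] := ltnP i j.
  by rewrite !ne_entry_eq0 ?mulr0 ?addr0 //; lia.
have [eji|nji] := eqVneq j i.
  rewrite [ne_entry k i.-1 j]ne_entry_eq0 ?mulr0 ?addr0; last by lia.
  rewrite /ne_entry eji leqnn ki (ltnW ki) /=.
  rewrite (_ : (i + i - k = 2 * i - k)%N); last by lia.
  rewrite (_ : (i + i - k.+1 = 2 * i - k.+1)%N); last by lia.
  have := fact_natr_neq0 (i - k); have := fact_natr_neq0 (i - k.+1).
  have := fact_natr_neq0 (2 * i - k); have := fact_natr_neq0 (2 * i - k.+1).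
  have := fact_natr_neq0 (i - i); have := fact_natr_neq0 i.
  have := exp2_natr_neq0 i.
  move=> *; field.
  by do !(apply/andP; split).
have {}ji : (j < i)%N by lia.
have {nji} key : (i + j - k)%:R * (i - k)%:R =
    (j - k)%:R * (2 * i - k)%:R + (i - j)%:R * i%:R :> R.
  rewrite -!natrM -natrD; congr _%:R.
  have [q ejq] : exists q, j = (k + q)%N by exists (j - k)%N; lia.
  have [p eip] : exists p, i = (j + p)%N by exists (i - j)%N; lia.
  have -> : (i + j - k = k + 2 * q + p)%N by lia.
  have -> : (i - k = q + p)%N by lia.
  have -> : (2 * i - k = k + 2 * q + 2 * p)%N by lia.
  by rewrite eip addKn ejq addKn; ring.
have nz m : (0 < m)%N -> m%:R != 0 :> R by rewrite pnatr_eq0 -lt0n.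
have i0 : i%:R != 0 :> R by apply: nz; lia.
have ij0 : (i - j)%:R != 0 :> R by apply: nz; lia.
have z0 : (2 * i - k)%:R != 0 :> R by apply: nz; lia.
have z1 : (2 * i - k.+1)%:R != 0 :> R by apply: nz; lia.
have fE := natr_fact_prev.
pose C : R := (i + j - k.+1)`!%:R * (2 * i)`!%:R * (i - k.+1)`!%:R /
  ((2 ^ j)%:R * (i - j.+1)`!%:R * (j - k)`!%:R * (2 * i - k.+2)`!%:R *
   i.-1`!%:R).
have -> : ne_entry k i j = C * ((i + j - k)%:R * (i - k)%:R) /
    ((i - j)%:R * (2 * i - k)%:R * (2 * i - k.+1)%:R * i%:R).
  rewrite /ne_entry ifT; last by lia.
  rewrite (fE (i + j - k)%N (i + j - k.+1)%N); last by lia.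
  rewrite (fE (i - k)%N (i - k.+1)%N); last by lia.
  rewrite (fE (i - j)%N (i - j.+1)%N); last by lia.
  rewrite (fE i i.-1); last by lia.
  rewrite (fE (2 * i - k)%N (2 * i - k.+1)%N); last by lia.
  rewrite (fE (2 * i - k.+1)%N (2 * i - k.+2)%N); last by lia.
  by rewrite /C !invfM !mulrA; ring.
have -> : ne_entry k.+1 i j = C * (j - k)%:R /
    ((i - j)%:R * (2 * i - k.+1)%:R * i%:R).
  have [ejk|njk] := eqVneq j k.
    by rewrite ne_entry_eq0 ?ejk ?subnn ?mulr0 ?mul0r // ltnn.
  have jk0 : (j - k)%:R != 0 :> R by apply: nz; lia.
  rewrite /ne_entry ifT /C; last by lia.
  rewrite (fE (i - j)%N (i - j.+1)%N); last by lia.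
  rewrite (fE (j - k)%N (j - k.+1)%N); last by lia.
  rewrite (fE i i.-1); last by lia.
  rewrite (fE (2 * i - k.+1)%N (2 * i - k.+2)%N); last by lia.
  by rewrite -[LHS](mulfK jk0) !invfM !mulrA; ring.
have -> : bessel_mult R i.+1 k.+1 * ne_entry k i.-1 j =
    C / ((2 * i - k)%:R * (2 * i - k.+1)%:R).
  rewrite /ne_entry /bessel_mult ifT; last by lia.
  have -> : (i.-1 + j - k = i + j - k.+1)%N by lia.
  have -> : (i.-1 - k = i - k.+1)%N by lia.
  have -> : (i.-1 - j = i - j.+1)%N by lia.
  have -> : (2 * i.+1 - 2 = 2 * i)%N by lia.
  have -> : (2 * i.+1 - 3 = 2 * i - 1)%N by lia.
  have -> : (2 * i.+1 - k.+1 - 1 = 2 * i - k)%N by lia.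
  have -> : (2 * i.+1 - k.+1 - 2 = 2 * i - k.+1)%N by lia.
  have -> : (2 * i.-1 - k = 2 * i - k.+2)%N by lia.
  have -> : (2 * i.-1 = 2 * i - 2)%N by lia.
  rewrite (natrM _ (2 * i)) (natrM _ (2 * i - k)) /C.
  rewrite (fE (2 * i)%N (2 * i - 1)%N); last by lia.
  rewrite (fE (2 * i - 1)%N (2 * i - 2)%N); last by lia.
  by rewrite !invfM !mulrA; ring.
rewrite key.
move: C ((i - j)%:R) (2 * i - k)%:R (2 * i - k.+1)%:R (i%:R) (j - k)%:R ij0 z0 z1 i0.
move=> C w z z' I v *; field.
by do !(apply/andP; split).
Qed.

Lemma semifactSS i : semifact i.+2 = (i.+2 * semifact i)%N.
Proof.
rewrite /semifact /= big_nat_recl //= muln0 subn0; congr muln.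
by apply: eq_bigr => k _; lia.
Qed.

(** Splitting (2i)! into its even and odd factors.  At i = 0 the truncated
    2 * 1 - 3 is 0, whose semifactorial is the empty product 1. *)
Lemma fact_double i : ((2 * i)`! = 2 ^ i * i`! * semifact (2 * i.+1 - 3))%N.
Proof.
elim: i => [|i IHi]; first by rewrite /semifact /= big_geq.
case: i IHi => [|i] IHi; first by rewrite /semifact /= big_geq.
have -> : (2 * i.+3 - 3 = (2 * i.+2 - 3).+2)%N by lia.
have e : (2 * i.+2 = (2 * i.+1).+2)%N by lia.
rewrite semifactSS e 2!factS IHi (expnS 2 i.+1) (factS i.+1).
have -> : ((2 * i.+1).+2 - 3).+2 = (2 * i.+1).+1 by lia.
by rewrite -e; ring.
Qed.

Lemma ne_entry_diag i : ne_entry i i i = (semifact (2 * i.+1 - 3))%:R.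
Proof.
rewrite /ne_entry leqnn /= fact_double addnK subnn.
have -> : (2 * i - i = i)%N by lia.
rewrite fact0 !natrM.
have := fact_natr_neq0 i; have := exp2_natr_neq0 i.
by move=> *; field; do !(apply/andP; split).
Qed.

(** The product in the pivot formula telescopes to a quotient of two falling
    factorials. *)
Lemma prod_pivot a m n : (m <= n)%N ->
  \prod_(1 <= r < m.+1) ((n.+1 - r)%:R / (a + r)%:R) =
  (n`! * a`!)%:R / ((n - m)`! * (a + m)`!)%:R :> R.
Proof.
elim: m => [_|m IHm mn].
  rewrite big_geq // subn0 addn0 divff //.
  by rewrite natrM mulf_neq0 ?fact_natr_neq0.
rewrite big_nat_recr //= IHm ?(ltnW mn) //.
have -> : (n.+1 - m.+1 = (n - m.+1).+1)%N by lia.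
have -> : (n - m = (n - m.+1).+1)%N by lia.
have -> : (a + m.+1 = (a + m).+1)%N by lia.
rewrite !factS !natrM.
have := fact_natr_neq0 (n - m.+1); have := fact_natr_neq0 (a + m).
have := ler0n R (n - m.+1); have := ler0n R (a + m); rewrite natrD => *; field.
by repeat (apply/andP; split => //); apply: lt0r_neq0; lra.
Qed.

Lemma ne_entry_pivot k i : (k <= i)%N ->
  ne_entry k i k = bessel_pivot R i.+1 k.+1.
Proof.
move=> ki; rewrite /bessel_pivot /ne_entry leqnn ki /=.
rewrite (eq_big_nat _ _ (F2 := fun r => ((2 * i).+1 - r)%:R / (i - k + r)%:R));
  last by move=> r _; congr (_%:R / _%:R); lia.
rewrite prod_pivot; last by lia.
rewrite !subSS !subn0 addnK subnn fact0 subnK // !natrM.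
have := fact_natr_neq0 (i - k); have := fact_natr_neq0 (2 * i - k).
have := fact_natr_neq0 i; have := exp2_natr_neq0 k.
by move=> *; field; do !(apply/andP; split).
Qed.

(** The recurrence at j = k, where the next stage has a zero. *)
Lemma ne_entry_mult k i : (k < i)%N ->
  ne_entry k i k / ne_entry k i.-1 k = bessel_mult R i.+1 k.+1.
Proof.
move=> ki; rewrite [ne_entry k i k]ne_entry_rec // ne_entry_eq0 ?add0r ?ltnn //.
by rewrite mulfK // lt0r_neq0 // ne_entry_gt0 // leqnn -ltnS prednK; lia.
Qed.

Lemma bessel_entryE i j : bessel_entry R i.+1 j.+1 = ne_entry 0 i j.
Proof.
rewrite /bessel_entry /ne_entry ltnS /=; case: ifP => // _.
have -> : (i.+1 + j.+1 - 2 = i + j - 0)%N by lia.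
rewrite !subSS !subn0 !natrM.
have := fact_natr_neq0 (2 * i); have := fact_natr_neq0 (i - j).
have := fact_natr_neq0 j; have := fact_natr_neq0 i; have := exp2_natr_neq0 j.
by move=> *; field; do !(apply/andP; split).
Qed.

Lemma bessel_mult_ge0 i j : 0 <= bessel_mult R i j.
Proof. by rewrite divr_ge0 ?ler0n. Qed.

End ClosedForm.
(** * Total positivity of bidiagonal products *)

Section TotalPositivity.
Variables (R : realFieldType) (n : nat).
Implicit Types A B C : 'M[R]_n.

Definition incr_fun k l (f : 'I_k -> 'I_l) :=
  forall i j : 'I_k, (i < j)%N -> (f i < f j)%N.

Definition nondecr_fun k l (f : 'I_k -> 'I_l) :=
  forall i j : 'I_k, (i <= j)%N -> (f i <= f j)%N.

(** Its image of the sorted enumeration of the indices is sorted with the same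
    elements, hence the same sequence. *)
Lemma incr_fun_id k (s : 'I_k -> 'I_k) : incr_fun s -> s =1 id.
Proof.
move=> s_incr i.
have s_inj : injective s.
  move=> x y exy; apply/val_inj/eqP; rewrite eqn_leq.
  case: (ltngtP (val x) (val y)) => // /s_incr; rewrite exy ltnn //.
pose lto := [rel x y : 'I_k | (x < y)%N].
have lto_trans : transitive lto by move=> y x z; apply: ltn_trans.
have lto_enum : sorted lto (enum 'I_k).
  have := iota_ltn_sorted 0 k; by rewrite -val_enum_ord sorted_map.
have e : map s (enum 'I_k) = enum 'I_k.
  apply: (irr_sorted_eq lto_trans) => //; first by move=> x; rewrite /= ltnn.
    rewrite sorted_map; apply: sub_sorted lto_enum => x y; exact: s_incr.
  move=> x; rewrite mem_enum; apply/mapP; exists (invF s_inj x).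
    by rewrite mem_enum.
  by rewrite f_invF.
by have /eq_in_map := etrans e (esym (map_id _)); apply; rewrite mem_enum.
Qed.

(** A nonzero term of the Leibniz expansion of a minor forces f i = g (s i) for
    all i; as f and g increase, so does the permutation s, which is then the
    identity.  The remaining term is a product of diagonal entries or zero. *)
Lemma diag_totally_positive (d : 'rV[R]_n) :
  (forall i, 0 <= d 0 i) -> totally_positive (diag_mx d).
Proof.
move=> d_ge0 k f g f_incr g_incr; rewrite /determinant sumr_ge0 // => s _.
have [->|s_neq1] := eqVneq s 1%g.
  rewrite odd_perm1 expr0 mul1r prodr_ge0 // => i _.
  by rewrite !mxE mulrn_wge0.
have [/forallP fgs|] := boolP [forall i, f i == g (s i)].
  case/eqP: s_neq1; apply/permP => i; rewrite perm1.
  apply: (@incr_fun_id _ s) => {}i j ij; case: ltngtP => // [|eij].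
    by move=> /g_incr; rewrite -!(eqP (fgs _)) ltnNge ltnW // f_incr.
  by move: ij => /f_incr; rewrite (eqP (fgs i)) (eqP (fgs j)) (val_inj eij) ltnn.
rewrite negb_forall => /existsP[i fgs].
by rewrite (bigD1 i) //= !mxE (negbTE fgs) mulr0n mul0r mulr0.
Qed.

(** Allowing repeated rows only adds minors that vanish. *)
Lemma minor_ge0_nondecr A k (f g : 'I_k -> 'I_n) : totally_positive A ->
  nondecr_fun f -> incr_fun g -> 0 <= \det (mxsub f g A).
Proof.
move=> A_tp f_nd g_incr.
have [/injectiveP f_inj|/injectivePn[i [j nij fij]]] := boolP (injectiveb f).
  apply: A_tp => // i j ij; rewrite ltn_neqAle f_nd ?(ltnW ij) // andbT.
  by apply: contraTneq ij => /val_inj/f_inj ->; rewrite ltnn.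
by rewrite (determinant_alternate nij) // => l; rewrite !mxE fij.
Qed.

(** Expand a minor of the new matrix, row by row, by multilinearity: it becomes
    a combination with nonnegative coefficients of determinants of rows of A
    where each chosen row index f i is either kept or lowered by one.  Lowering
    some of a strictly increasing list of integers by one leaves it
    nondecreasing, so these are minors of A or zero.  At row 0 the
    predecessor is row 0 itself, and the argument is the same. *)
Lemma bidiag_totally_positive A (w : 'I_n -> R) : (forall r, 0 <= w r) ->
  totally_positive A ->
  totally_positive (\matrix_(r, c) (A r c + w r * A (ord_subn r 1) c)).
Proof.
move=> w_ge0 A_tp k f g f_incr g_incr.
(* The rows from m on are already expanded, according to the choice h. *)
pose mixed m (h : 'I_k -> 'I_n) : 'M[R]_k :=
  \matrix_(i, j) if (i < m)%N
    then A (f i) (g j) + w (f i) * A (ord_subn (f i) 1) (g j)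
    else A (h i) (g j).
pose adm m (h : 'I_k -> 'I_n) := forall i : 'I_k,
  if (i < m)%N then h i = f i else h i = f i \/ h i = ord_subn (f i) 1.
suff mixed_ge0 m h : (m <= k)%N -> adm m h -> 0 <= \det (mixed m h).
  have -> : mxsub f g (\matrix_(r, c) (A r c + w r * A (ord_subn r 1) c)) =
      mixed k f by apply/matrixP => i j; rewrite !mxE ltn_ord.
  by apply: mixed_ge0 => // i; rewrite ltn_ord.
elim: m h => [|m IHm] h mk h_adm.
  have -> : mixed 0 h = mxsub h g A by apply/matrixP => i j; rewrite !mxE.
  apply: minor_ge0_nondecr => // i j; rewrite leq_eqVlt => /predU1P[/val_inj->//|].
  move=> /f_incr; case: (h_adm i) => ->; case: (h_adm j) => -> /=; lia.
pose i0 := Ordinal mk.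
pose h' i := if i == i0 then ord_subn (f i0) 1 else h i.
have ltS (i : 'I_k) : i != i0 -> (i < m.+1)%N = (i < m)%N.
  by move=> /eqP ne; rewrite ltnS leq_eqVlt; case: eqP => // e; case: ne; apply: val_inj.
have hi0 : h i0 = f i0 by have := h_adm i0; rewrite /= ltnSn.
rewrite (@determinant_multilinear _ _ _ (mixed m h) (mixed m h') i0 1 (w (f i0))).
- rewrite mul1r addr_ge0 ?mulr_ge0 //; apply: IHm (ltnW mk) _ => i.
    have [->|ne] := eqVneq i i0; first by rewrite ltnn hi0; left.
    by have := h_adm i; rewrite ltS.
  rewrite /h'; have [->|ne] := eqVneq i i0; first by rewrite ltnn; right.
  by have := h_adm i; rewrite ltS.
- by apply/rowP => j; rewrite !mxE /= ltnSn ltnn /h' eqxx hi0 mul1r.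
- apply/matrixP => i j; rewrite !mxE ltS //; rewrite eq_sym; exact: neq_lift.
- apply/matrixP => i j; rewrite !mxE ltS; last by rewrite eq_sym neq_lift.
  by rewrite /h' (eq_sym _ i0) (negbTE (neq_lift _ _)).
Qed.
End TotalPositivity.

(** * Neville elimination and bidiagonal factors in general *)

Section NevilleGeneral.
Variables (R : realFieldType) (n : nat).
Implicit Types (A B M : 'M[R]_n) (i j r t : 'I_n).

(** If the nonzero entries of column t from the diagonal down come first, the
    row order is a sorted enumeration of all indices, so it is the trivial
    one. *)
Lemma ne_move_id t M :
  (forall i j, (t <= i)%N -> (i <= j)%N -> M j t != 0 -> M i t != 0) ->
  ne_move t M = M.
Proof.
move=> nz_prefix; pose lto := [rel i j : 'I_n | (i < j)%N].
have lto_enum : pairwise lto (enum 'I_n).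
  rewrite -(pairwise_map val ltn) val_enum_ord -sorted_pairwise ?iota_ltn_sorted //.
  exact: ltn_trans.
have lto_filter (p : pred 'I_n) : pairwise lto [seq i <- enum 'I_n | p i].
  exact: pairwise_filter.
suff e : ne_order t M = enum 'I_n.
  by apply/matrixP => i j; rewrite mxE e nth_ord_enum.
apply: (@irr_sorted_eq _ lto).
- by move=> j i k; apply: ltn_trans.
- by move=> i; rewrite /= ltnn.
- apply: pairwise_sorted; rewrite /ne_order !pairwise_cat !lto_filter !andbT.
  apply/andP; split; apply/allrelP => i j.
    rewrite mem_cat !mem_filter => /andP[it _] /orP[]/andP[/andP[tj _] _];
    exact: leq_trans it tj.
  rewrite !mem_filter => /andP[/andP[ti nzi] _] /andP[/andP[tj zj] _] /=.
  by rewrite ltnNge; apply: contraL zj => ji; apply: nz_prefix nzi.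
- exact: pairwise_sorted.
- move=> i; have in_filter (p : pred 'I_n) : (i \in [seq k <- enum 'I_n | p k]) = p i.
    by rewrite mem_filter mem_enum andbT.
  rewrite /ne_order !mem_cat !in_filter mem_enum.
  by case: ltnP => //= _; case: (M i t =P 0).
Qed.

Section UpperTriangular.
Variable M : 'M[R]_n.
Hypothesis M_upper : forall i j, (j < i)%N -> M i j = 0.

Lemma ne_move_upper t : ne_move t M = M.
Proof.
apply: ne_move_id => i j ti; rewrite leq_eqVlt => /predU1P[/val_inj->//|ij].
by rewrite M_upper ?eqxx // (leq_ltn_trans ti).
Qed.

Lemma ne_seq_upper k : ne_seq M k = M.
Proof.
elim: k => //= k ->; case: insubP => //= t _ _; rewrite ne_move_upper.
apply/matrixP => i j; rewrite mxE; case: ifP => // /and3P[_ ti _].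
by rewrite (M_upper ti) !mul0r subr0.
Qed.

Lemma ne_mult_upper i j : (j < i)%N -> ne_mult M i j = 0.
Proof.
move=> ji; rewrite /ne_mult /ne_pivot /ne_tilde !ne_seq_upper !ne_move_upper.
by rewrite (M_upper ji) mul0r if_same.
Qed.

End UpperTriangular.

(** Multiplying by a bidiagonal factor adds to each row a multiple of the
    preceding one: the form in which [bidiag_totally_positive] applies.  For
    r = 0 the predecessor is 0 by truncation, but its coefficient vanishes since
    k > 0. *)
Lemma bd_factor_mul B M k : (0 < k)%N ->
  bd_factor B k *m M =
  \matrix_(r, c) (M r c + (if (k <= r)%N then B r (ord_subn r k) else 0) *
                          M (ord_subn r 1) c).
Proof.
move=> k_gt0; apply/matrixP => r c; rewrite !mxE (bigD1 r) //= mxE eqxx mul1r.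
congr (_ + _); have [kr|rk] := leqP k r; last first.
  rewrite mul0r big1 // => l /negbTE lr; rewrite mxE lr leqNgt rk andbF mul0r //.
rewrite (bigD1 (ord_subn r 1)) /=; last by rewrite -val_eqE /=; lia.
rewrite mxE -val_eqE /= kr ifF; last by lia.
rewrite ifT; last by lia.
rewrite big1 ?addr0 // => l /andP[/negbTE lr]; rewrite -val_eqE mxE lr /= => l1.
by rewrite ifF ?mul0r //; lia.
Qed.

Lemma bd_factor_upper_id B k : (0 < k)%N ->
  (forall i j, (j < i)%N -> B i j = 0) -> bd_factor B k = 1%:M.
Proof.
move=> k_gt0 B_upper; apply/matrixP => r c; rewrite !mxE eq_sym.
case: eqP => // _; case: ifP => // /andP[_ kr].
by rewrite B_upper //=; lia.
Qed.

End NevilleGeneral.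

(** * The Bessel matrix *)

Section BesselMatrix.
Variables (R : realFieldType) (n : nat).
Implicit Types (i j r t : 'I_n).
Let A := bessel_mx R n.

(** The minimum accounts for the rows that are final: row i does not change
    after step i. *)
Definition ne_stage k : 'M[R]_n := \matrix_(i, j) ne_entry R (minn i k) i j.

Lemma ne_move_stage t : ne_move t (ne_stage t) = ne_stage t.
Proof.
apply: ne_move_id => i j ti _ _; rewrite mxE (minn_idPr ti).
by rewrite lt0r_neq0 // ne_entry_gt0 // leqnn.
Qed.

Lemma ne_elim_stage t : ne_elim t (ne_stage t) = ne_stage t.+1.
Proof.
apply/matrixP => i j; rewrite !mxE /=.
have [ti|it] := ltnP t i; last first.
  by rewrite andbF; congr (ne_entry _ _ _ _); lia.
have -> : minn (i - 1) t = t by lia.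
have -> : minn i t.+1 = t.+1 by lia.
have [tj|jt] := leqP t j; last by rewrite /= !ne_entry_eq0 //; lia.
rewrite ifT; last first.
  by rewrite /= lt0r_neq0 // ne_entry_gt0 //; lia.
by rewrite subn1 ne_entry_mult // [ne_entry R t i j]ne_entry_rec // addrK.
Qed.

Lemma ne_seq_bessel k : (k <= n)%N -> ne_seq A k = ne_stage k.
Proof.
elim: k => [_|k IHk kn] /=.
  by apply/matrixP => i j; rewrite !mxE minn0 bessel_entryE.
by rewrite insubT IHk ?(ltnW kn) // -(ne_elim_stage (Sub k kn)) (ne_move_stage (Sub k kn)).
Qed.

Lemma ne_tilde_bessel t : ne_tilde A t = ne_stage t.
Proof. by rewrite /ne_tilde ne_seq_bessel ?ne_move_stage // ltnW. Qed.

Lemma ne_pivot_bessel i j : (j <= i)%N -> ne_pivot A i j = ne_entry R j i j.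
Proof. by move=> ji; rewrite /ne_pivot ne_tilde_bessel mxE (minn_idPr ji). Qed.

Lemma ne_mult_bessel i j : (j < i)%N -> ne_mult A i j = bessel_mult R i.+1 j.+1.
Proof.
move=> ji; have ji1 : (j <= ord_subn i 1)%N by rewrite /=; lia.
rewrite /ne_mult !ne_pivot_bessel ?(ltnW ji) // ne_tilde_bessel mxE (minn_idPr ji1).
rewrite ifT; last by rewrite lt0r_neq0 // ne_entry_gt0 // leqnn.
by rewrite /= subn1 ne_entry_mult.
Qed.

Lemma bessel_mx_trig i j : (i < j)%N -> A i j = 0.
Proof. by move=> ij; rewrite mxE /bessel_entry ltnS leqNgt ij. Qed.

Lemma bd_mx_bessel : bd_mx A = bessel_bd_mx R n.
Proof.
apply/matrixP => i j; rewrite !mxE /bessel_bd !ltnS.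
have [ij|ji|/val_inj eij] := ltngtP i j.
- by apply: ne_mult_upper => // k l lk; rewrite mxE bessel_mx_trig.
- exact: ne_mult_bessel.
rewrite ne_pivot_bessel // ne_entry_diag /=; case: eqP => // -[i0].
by rewrite i0 /semifact big_geq.
Qed.

(** The product F_k ... F_1 D.  Row r collects what elimination had made of row
    r when k steps, or all r of them if r < k, were still to come. *)
Definition partial_prod k : 'M[R]_n := \matrix_(r, c) ne_entry R (r - k) r c.

(** The recurrence of the closed form at stage r - k: row r - 1 of
    partial_prod k.-1 is at the same stage r - k, and row r at the next
    one. *)
Lemma partial_prodS k : (0 < k)%N ->
  partial_prod k =
  \matrix_(r, c) (partial_prod k.-1 r c +
    (if (k <= r)%N then bessel_bd_mx R n r (ord_subn r k) else 0) *
    partial_prod k.-1 (ord_subn r 1) c).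
Proof.
move=> k_gt0; apply/matrixP => r c; rewrite !mxE /=.
case: leqP => [kr|rk]; last first.
  by rewrite mul0r addr0; congr (ne_entry _ _ _ _); lia.
rewrite ne_entry_rec; last by lia.
rewrite /bessel_bd ifT; last by lia.
by congr (ne_entry _ _ _ _ + _ * ne_entry _ _ _ _); lia.
Qed.

Lemma bd_factor_partial_prod k : (k < n)%N ->
  (\prod_(n - k <= l < n) bd_factor (bessel_bd_mx R n) (n - l)) *m
    partial_prod 0 = partial_prod k.
Proof.
elim: k => [|k IHk] kn; first by rewrite subn0 big_geq // mul1mx.
rewrite big_ltn; last by lia.
have -> : (n - k.+1).+1 = (n - k)%N by lia.
rewrite -mulmxE -mulmxA IHk ?(ltnW kn) // bd_factor_mul; last by lia.
have -> : (n - (n - k.+1) = k.+1)%N by lia.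
by rewrite [partial_prod k.+1]partial_prodS.
Qed.

Lemma partial_prod0 :
  partial_prod 0 = diag_mx (\row_i (bessel_bd_mx R n) i i).
Proof.
apply/matrixP => r c; rewrite !mxE subn0 /bessel_bd ltnn.
have [<-|rc] := eqVneq r c; last first.
  by rewrite mulr0n ne_entry_eq0 //; move: rc; rewrite -val_eqE /=; lia.
rewrite ne_entry_diag; case: eqP => // -[r0].
by rewrite r0 /semifact big_geq.
Qed.

Lemma partial_prod_last k : (n.-1 <= k)%N -> partial_prod k = A.
Proof.
move=> nk; apply/matrixP => r c; rewrite !mxE bessel_entryE.
by congr (ne_entry _ _ _ _); have := ltn_ord r; lia.
Qed.

Lemma bessel_bd_prod : (0 < n)%N -> A = bd_prod (bd_mx A).
Proof.
move=> n_gt0; rewrite bd_mx_bessel /bd_prod -partial_prod0.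
have := @bd_factor_partial_prod n.-1.
have -> : (n - n.-1 = 1)%N by lia.
move=> ->; last by lia.
rewrite partial_prod_last // [X in _ *m X]big1_seq ?mulmx1 // => k.
rewrite mem_index_iota => /andP[_ /andP[k_gt0 _]].
rewrite bd_factor_upper_id ?trmx1 // => i j ji.
by rewrite !mxE /bessel_bd !ltnS ltnNge (ltnW ji) ji.
Qed.

Lemma partial_prod_tp k : totally_positive (partial_prod k).
Proof.
elim: k => [|k IHk].
  rewrite partial_prod0; apply: diag_totally_positive => i.
  by rewrite !mxE /bessel_bd ltnn; case: ifP; rewrite ?ler01 ?ler0n.
rewrite partial_prodS //; apply: bidiag_totally_positive IHk => r.
case: leqP => // kr; rewrite mxE /bessel_bd ifT ?bessel_mult_ge0 //=; lia.
Qed.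

Lemma bessel_mx_tp : totally_positive A.
Proof. by rewrite -(partial_prod_last (leqnn _)); apply: partial_prod_tp. Qed.

Lemma bessel_mx_unit : A \in unitmx.
Proof.
rewrite unitmxE det_trig; last by apply/is_trig_mxP => i j; apply: bessel_mx_trig.
rewrite unitfE; apply/prodf_neq0 => i _.
by rewrite mxE bessel_entryE lt0r_neq0 // ne_entry_gt0 //= leqnn.
Qed.

Lemma bessel_poly_row i x :
  (bessel_poly R i).[x] = \sum_(j < n) A i j * x ^+ j.
Proof.
rewrite /bessel_poly horner_poly (big_ord_widen n (fun k =>
  (i + k)`!%:R / (2 ^ k * (i - k)`! * k`!)%:R * x ^+ k)) //.
rewrite big_mkcond; apply: eq_bigr => j _; rewrite mxE /bessel_entry ltnS.
case: ifP => _; last by rewrite mul0r.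
have -> : (i.+1 + j.+1 - 2 = i + j)%N by lia.
by rewrite !subSS !subn0.
Qed.

(** Each row of the difference M - A is a polynomial of degree less than n that
    vanishes at every element of the field, in particular at 0, ..., n - 1. *)
Lemma bessel_mx_unique (M : 'M[R]_n) :
  (is_trig_mx M /\
   forall x : R, \col_(i < n) (bessel_poly R i).[x] = M *m \col_(j < n) x ^+ j)
  <-> M = A.
Proof.
split=> [[_ MB]|->]; last first.
  split=> [|x]; first by apply/is_trig_mxP => i j; apply: bessel_mx_trig.
  apply/colP => i; rewrite !mxE bessel_poly_row.
  by apply: eq_bigr => j _; rewrite mxE.
apply/matrixP => i j; pose p := \poly_(k < n) (if insub k is Some l then M i l - A i l else 0).
suff p0 : p = 0.
  have := congr1 (fun q : {poly R} => q`_j) p0.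
  by rewrite coef_poly ltn_ord coef0 valK => /subr0_eq.
apply: (@roots_geq_poly_eq0 _ _ [seq k%:R | k <- iota 0 n]).
- apply/allP => _ /mapP[k _ ->]; rewrite /root horner_poly.
  under eq_bigr => l _ do rewrite valK mulrBl.
  rewrite sumrB -bessel_poly_row subr_eq0.
  have /colP/(_ i) := MB k%:R; rewrite !mxE => ->.
  by apply/eqP/eq_bigr => l _; rewrite mxE.
- by rewrite map_inj_uniq ?iota_uniq // => k l /eqP; rewrite eqr_nat => /eqP.
- by rewrite size_map size_iota size_poly.
Qed.

End BesselMatrix.

(** * The algorithm *)

Section Algorithm.
Variable R : realFieldType.

Lemma foldl_obind_inv (S : Type) (step : nat -> S -> option S)
    (Inv : nat -> S -> Prop) n s0 :
  Inv 0 s0 ->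
  (forall m s, (m < n)%N -> Inv m s ->
     exists2 s', step m.+1 s = Some s' & Inv m.+1 s') ->
  exists2 s, foldl (fun o k => obind (step k) o) (Some s0) (index_iota 1 n.+1)
             = Some s & Inv n s.
Proof.
move=> Inv0 Inv_step; rewrite /index_iota subn1 /=.
elim: n Inv_step => [|n IHn] Inv_step; first by exists s0.
have [m s mn|s run_s Inv_s] := IHn; first by apply: Inv_step; apply: leqW.
have [s' step_s Inv_s'] := Inv_step n s (leqnn _) Inv_s; exists s' => //.
by rewrite -[n.+1]addn1 iotaD foldl_cat run_s /= add1n.
Qed.

(** Index 0 is the row and Index 1 the column, counted from 1.  Register 0
    holds the diagonal entry of the current row. *)
Definition bd_cell_prog : hra_prog :=
  let i := Index 0 in let j := Index 1 in
  let i1 := SubData i (Const 1) in let i2 := SubData i (Const 2) in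
  IfLt j i
    (Output i j (Div (Mul (Add i1 i1) (Add i1 i2))
                     (Mul (Add (SubData i j) i1) (Add (SubData i j) i2))))
    (IfLt i j (Output i j (Datum (Const 0))) (Output i j (Reg 0))).

(** 2i - 3 is computed as (i - 1) + (i - 2), where both terms are nonnegative
    for i >= 2.  The multiplication is wanted at i = 2 too: there the
    factor is 1. *)
Definition semifact_prog : hra_prog :=
  let i := Index 0 in
  IfLt i (Const 2) (Assign 0 (Datum (Const 1)))
    (Assign 0 (Mul (Reg 0) (Add (SubData i (Const 1)) (SubData i (Const 2))))).

Definition bd_prog : hra_prog :=
  For 0 (Const 1) Size (Seq semifact_prog (For 1 (Const 1) Size bd_cell_prog)).

(** Values that are images of natural numbers are nonnegative, so additions of
    such values are always admissible. *)
Section Semantics.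
Variables (n : nat) (e : nat -> nat) (s : hra_state R).
Implicit Types (a b : hra_expr) (x y : R).

Lemma hra_eval_subdata d d' : (datum_val n e d' <= datum_val n e d)%N ->
  hra_eval n e s (SubData d d') = Some (datum_val n e d - datum_val n e d')%:R.
Proof. by move=> dd' /=; rewrite natrB. Qed.

Lemma hra_eval_add_nat a b k l :
  hra_eval n e s a = Some k%:R -> hra_eval n e s b = Some l%:R ->
  hra_eval n e s (Add a b) = Some (k + l)%:R.
Proof. by move=> /= -> ->; rewrite mulr_ge0 ?ler0n // natrD. Qed.

Lemma hra_eval_mul_nat a b k l :
  hra_eval n e s a = Some k%:R -> hra_eval n e s b = Some l%:R ->
  hra_eval n e s (Mul a b) = Some (k * l)%:R.
Proof. by move=> /= -> ->; rewrite natrM. Qed.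

Lemma hra_eval_div a b x y :
  hra_eval n e s a = Some x -> hra_eval n e s b = Some y -> y != 0 ->
  hra_eval n e s (Div a b) = Some (x / y).
Proof. by move=> /= -> -> ->. Qed.

Lemma hra_run_assign r a x : hra_eval n e s a = Some x ->
  hra_run n e (Assign r a) s =
  Some (HraState [eta regs s with r |-> Some x] (result s)).
Proof. by move=> /= ->. Qed.

Lemma hra_run_output d d' a x : hra_eval n e s a = Some x ->
  hra_run n e (Output d d' a) s =
  Some (HraState (regs s) (fun k l =>
    if (k == datum_val n e d) && (l == datum_val n e d') then Some x
    else result s k l)).
Proof. by move=> /= ->. Qed.

Lemma hra_run_iflt d d' p q : hra_run n e (IfLt d d' p q) s =
  if (datum_val n e d < datum_val n e d')%N then hra_run n e p s
  else hra_run n e q s.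
Proof. by []. Qed.

Lemma hra_run_seq s' p q : hra_run n e p s = Some s' ->
  hra_run n e (Seq p q) s = hra_run n e q s'.
Proof. by move=> /= ->. Qed.

Lemma hra_run_for v d d' q : hra_run n e (For v d d' q) s =
  foldl (fun o k => obind (hra_run n [eta e with v |-> k] q) o) (Some s)
    (index_iota (datum_val n e d) (datum_val n e d').+1).
Proof. by []. Qed.

Lemma semifact_progP m : e 0%N = m.+1 ->
  ((0 < m)%N -> regs s 0 = Some (semifact (2 * m - 3))%:R) ->
  hra_run n e semifact_prog s =
  Some (HraState [eta regs s with 0%N |-> Some (semifact (2 * m.+1 - 3))%:R]
                 (result s)).
Proof.
move=> e0 reg_s; rewrite hra_run_iflt {1}/datum_val e0 {1}/datum_val.
case: ltnP => m1; apply: hra_run_assign.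
  have -> : m = 0%N by lia.
  by rewrite /= /semifact big_geq.
have -> : semifact (2 * m.+1 - 3) =
    (semifact (2 * m - 3) * ((m.+1 - 1) + (m.+1 - 2)))%N.
  have [->|m2] : m = 1%N \/ (1 < m)%N by lia.
    by rewrite /semifact !big_geq.
  have -> : (2 * m.+1 - 3 = (2 * m - 3).+2)%N by lia.
  by rewrite semifactSS mulnC; congr muln; lia.
apply: hra_eval_mul_nat; first exact: reg_s.
by apply: hra_eval_add_nat; rewrite hra_eval_subdata /= e0.
Qed.

Lemma bd_cell_progP i j : e 0%N = i -> e 1%N = j -> (0 < j)%N ->
  regs s 0 = Some (semifact (2 * i - 3))%:R ->
  hra_run n e bd_cell_prog s =
  Some (HraState (regs s) (fun k l =>
    if (k == i) && (l == j) then Some (bessel_bd R i j) else result s k l)).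
Proof.
move=> e0 e1 j_gt0 reg_s.
have valI : datum_val n e (Index 0) = i by [].
have valJ : datum_val n e (Index 1) = j by [].
rewrite !hra_run_iflt valI valJ /bessel_bd.
case: (ltngtP j i) => [ji|ij|eij]; rewrite -[in RHS]valI -[in RHS]valJ.
- apply: hra_run_output; rewrite /bessel_mult valI valJ.
  have -> : (2 * i - 2 = (i - 1) + (i - 1))%N by lia.
  have -> : (2 * i - 3 = (i - 1) + (i - 2))%N by lia.
  have -> : (2 * i - j - 1 = (i - j) + (i - 1))%N by lia.
  have -> : (2 * i - j - 2 = (i - j) + (i - 2))%N by lia.
  have i1 : hra_eval n e s (SubData (Index 0) (Const 1)) = Some (i - 1)%:R.
    by rewrite hra_eval_subdata valI //=; lia.
  have i2 : hra_eval n e s (SubData (Index 0) (Const 2)) = Some (i - 2)%:R.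
    by rewrite hra_eval_subdata valI //=; lia.
  have ij : hra_eval n e s (SubData (Index 0) (Index 1)) = Some (i - j)%:R.
    by rewrite hra_eval_subdata valI valJ // ltnW.
  apply: hra_eval_div; last by rewrite pnatr_eq0 muln_eq0; lia.
    by apply: hra_eval_mul_nat; apply: hra_eval_add_nat.
  by apply: hra_eval_mul_nat; apply: hra_eval_add_nat.
- exact: hra_run_output.
- apply: hra_run_output; rewrite /= reg_s e0.
  by case: eqP => // ->; rewrite /semifact big_geq.
Qed.

End Semantics.

Definition bd_rows_done n m (s : hra_state R) :=
  ((0 < m)%N -> regs s 0 = Some (semifact (2 * m - 3))%:R) /\
  forall i j, (0 < i <= m)%N -> (0 < j <= n)%N ->
    result s i j = Some (bessel_bd R i j).

Lemma bd_progP n : exists2 s : hra_state R,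
  hra_run n (fun=> 0%N) bd_prog (hra_init R) = Some s & bd_rows_done n n s.
Proof.
rewrite /bd_prog hra_run_for.
apply: foldl_obind_inv; first by split=> // i j; case: i.
move=> m s mn [reg_s res_s].
set e := [eta _ with 0%N |-> m.+1].
pose reg := Some (semifact (2 * m.+1 - 3))%:R : option R.
pose row_done l (s' : hra_state R) := [/\ regs s' 0 = reg,
  forall i j, (0 < i <= m)%N -> (0 < j <= n)%N ->
    result s' i j = Some (bessel_bd R i j) &
  forall j, (0 < j <= l)%N -> result s' m.+1 j = Some (bessel_bd R m.+1 j)].
set s1 := HraState [eta regs s with 0%N |-> reg] (result s).
have [||s2 run_s2 [reg_s2 res_s2 row_s2]] := @foldl_obind_inv (hra_state R)
    (fun k => hra_run n [eta e with 1%N |-> k] bd_cell_prog) row_done n s1.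
- by split=> // -[].
- move=> l s' ln [reg_s' res_s' row_s'].
  rewrite (@bd_cell_progP _ _ _ m.+1 l.+1) //; eexists; first reflexivity.
  split=> //= i.
    by move=> j im jn; rewrite ifF ?res_s' //; lia.
  move=> il; rewrite eqxx /=; case: eqP => [->//|ne]; apply: row_s'; lia.
exists s2.
  by rewrite -run_s2; apply: hra_run_seq; apply: semifact_progP.
split=> // i j /andP[i_gt0]; rewrite leq_eqVlt => /predU1P[->|im] jn.
  exact: row_s2.
by apply: res_s2; lia.
Qed.

End Algorithm.

Theorem theorem3 (R : realFieldType) :
  (forall n : nat, (0 < n)%N ->
    let A := bessel_mx R n in
    [/\ (* A is the lower triangular matrix defined by the B_i *)
        forall M : 'M[R]_n,
          (is_trig_mx M /\
           forall x : R, \col_(i < n) (bessel_poly R i).[x] =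
                         M *m \col_(j < n) x ^+ j) <-> M = A,
        (* (i) *)
        (forall i j : 'I_n, (j <= i)%N ->
           ne_pivot A i j = bessel_pivot R i.+1 j.+1) /\
        (forall i j : 'I_n, (j < i)%N ->
           ne_mult A i j = bessel_mult R i.+1 j.+1),
        (* (ii) *)
        A \in unitmx /\ totally_positive A
      & (* (iii) *)
        bd_mx A = bessel_bd_mx R n /\ A = bd_prod (bd_mx A)]) /\
  hra_computable (fun n => bd_mx (bessel_mx R n)).
Proof.
split=> [n n_gt0 A|].
  split.
  - exact: bessel_mx_unique.
  - split=> i j ji; last exact: ne_mult_bessel.
    by rewrite ne_pivot_bessel // ne_entry_pivot.
  - by split; [apply: bessel_mx_unit | apply: bessel_mx_tp].
  - by split; [apply: bd_mx_bessel | apply: bessel_bd_prod].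
exists bd_prog => n _; have [s run_s [_ res_s]] := bd_progP R n.
exists s => // i j; rewrite bd_mx_bessel mxE.
by apply: res_s; rewrite /= ltn_ord.
Qed.
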